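(* Let $k$ be a positive integer, let $X$ be a finite or countable set, and let $p\in\Delta(X)$. Then $$V(k,p)\le \sqrt{2k\,H(p)},$$ and thus, for every positive integer $d$, $$V(k,d)\le \sqrt{2k\log d}.$$
   Context: $\log$ is the natural logarithm. For a finite or countable set $X$, $\ell_1(X)$ is the space of $q\in\mathbb{R}^X$ with $\|q\|_1:=\sum_{x\in X}|q(x)|<\infty$ (where $q(x)$ is the $x$-th coordinate of $q$), and $\Delta(X)$ is the set of $p\in\mathbb{R}^X$ with $p(x)\ge 0$ for all $x$ and $\sum_{x\in X}p(x)=1$. A $k$-step $\ell_1(X)$-valued martingale $p_0^k=p_0,\ldots,p_k$ is a stochastic process (on some probability space) with $p_t$ taking values in $\ell_1(X)$ for $0\le t\le k$ and $E(p_t\mid p_0,\ldots,p_{t-1})=p_{t-1}$ for $1\le t\le k$. For $p\in\Delta(X)$, $\mathcal{M}_k(X,p)$ denotes the set of all such martingales with $p_t\in\Delta(X)$ for all $t$ and $p_0=p$ (the constant $p$). The variation of $p_0^k$ is $V(p_0^k)=E\left(\sum_{t=1}^k\|p_t-p_{t-1}\|_1\right)$. Set $$V(k,p):=\sup\{V(p_0^k): p_0^k\in\mathcal{M}_k(X,p)\},\qquad V(k,d):=\sup\{V(k,p): p\in\Delta(X)\text{ and }|X|=d\}.$$ The entropy is $H(p)=-\sum_{x\in X}p(x)\log p(x)\in[0,\infty]$, with $0\log 0=0$ (the first bound is vacuous if $H(p)=\infty$). *)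

(* Defs.v *)
From HB Require Import structures.
From mathcomp Require Import all_boot all_order all_algebra.
From mathcomp Require Import all_classical all_reals all_analysis.

Set Implicit Arguments.
Unset Strict Implicit.
Unset Printing Implicit Defensive.

Import Order.TTheory GRing.Theory Num.Theory.
Import numFieldNormedType.Exports.

Local Open Scope classical_set_scope.
Local Open Scope ring_scope.
Local Open Scope ereal_scope.

(* "X is a finite or countable set" is rendered by [X : countType]; every
   [finType] is one. A vector of R^X is a function [X -> R]. *)

Section simplex.
Context {R : realType} {X : countType}.
Implicit Type q : X -> R.

Definition l1_norm q : \bar R := \esum_(x in [set: X]) `|q x|%:E.

Definition l1 : set (X -> R) := [set q | l1_norm q < +oo].

Definition simplex : set (X -> R) :=
  [set q | (forall x, (0 <= q x)%R) /\ \esum_(x in [set: X]) (q x)%:E = 1].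

(* The summands are nonnegative on the simplex, where the supremum of finite
   partial sums computed by [\esum] is the sum of the series; and
   [0 * ln 0 = 0]. *)
Definition entropy q : \bar R :=
  \esum_(x in [set: X]) (- (q x * ln (q x)))%:E.

End simplex.

Section martingale.
Context {R : realType} {X : countType}.
Context {d : measure_display} {Omega : measurableType d}.
Implicit Types (P : probability Omega R) (p : nat -> Omega -> X -> R).
Implicit Types (G : set (set Omega)) (Y Z : Omega -> X -> R).

(* As X is countable, l1(X) is separable and its Borel sigma-algebra is
   generated by the coordinates; measurability with respect to G of an
   l1(X)-valued map is therefore required coordinatewise. *)
Definition l1_measurable G Y :=
  forall (x : X) (B : set R), measurable B -> G (Y ^~ x @^-1` B).

Definition l1_integrable P Y :=
  [/\ forall w, l1 (Y w), l1_measurable measurable Y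
    & \int[P]_w l1_norm (Y w) < +oo].

(* Z is a version of E(Y | G). The Bochner integral in l1(X) of an integrable
   map has as x-th coordinate the integral of the x-th coordinate. *)
Definition is_cond_exp P G Y Z :=
  [/\ l1_integrable P Y, l1_integrable P Z, l1_measurable G Z
    & forall A, G A -> forall x,
        \int[P]_(w in A) (Z w x)%:E = \int[P]_(w in A) (Y w x)%:E].

(* The sigma-algebra generated by p_0, ..., p_{t-1}. *)
Definition past p (t : nat) : set (set Omega) :=
  <<s [set A | exists s x (B : set R),
        [/\ (s < t)%N, measurable B & A = (p s ^~ x) @^-1` B]] >>.

(* Only p_0, ..., p_k matter: the values of p beyond k are junk. *)
Definition l1_martingale P (k : nat) p :=
  (forall t, (t <= k)%N -> l1_integrable P (p t)) /\
  (forall t, (1 <= t <= k)%N -> is_cond_exp P (past p t) (p t) (p t.-1)).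

Definition simplex_martingale P (k : nat) (p0 : X -> R) p :=
  [/\ l1_martingale P k p,
      forall t, (t <= k)%N -> forall w, simplex (p t w)
    & forall w, p 0%N w = p0].

Definition l1_variation P (k : nat) p : \bar R :=
  \int[P]_w \sum_(1 <= t < k.+1) l1_norm (p t w \- p t.-1 w)%R.

End martingale.

(* The supremum runs over all probability spaces. *)
Definition max_variation {R : realType} {X : countType} (k : nat)
    (p0 : X -> R) : \bar R :=
  ereal_sup [set v | exists (d : measure_display) (Omega : measurableType d)
    (P : probability Omega R) (p : nat -> Omega -> X -> R),
    simplex_martingale P k p0 p /\ v = l1_variation P k p].

Definition max_variation_card (R : realType) (k d : nat) : \bar R :=
  ereal_sup [set v | exists (X : finType) (p0 : X -> R),
    [/\ #|X| = d, simplex p0 & v = max_variation k p0]].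

(* Main.v *)
Require Import Defs.
From HB Require Import structures.
From mathcomp Require Import all_boot all_order all_algebra.
From mathcomp Require Import all_classical all_reals all_analysis.
From mathcomp Require Import measurable_realfun ring lra.

Set Implicit Arguments.
Unset Strict Implicit.
Unset Printing Implicit Defensive.

Import Order.TTheory GRing.Theory Num.Theory.
Import numFieldNormedType.Exports.

Local Open Scope classical_set_scope.
Local Open Scope ring_scope.

(** The textbook proof applies Pinsker's inequality to each increment: the
    conditional mean of the relative entropy of [p t] with respect to
    [p t.-1] is the expected drop of entropy, these drops telescope to at most
    [entropy p], and Cauchy-Schwarz over the [k] steps concludes. Here the same
    proof is run in linearised form, coordinate by coordinate, so that only
    martingales with values in [0, 1] occur.

    Put phi s = s ln s. The scalar inequality behind Pinsker's,
      3 (b - a)^2 <= (2 b + 4 a) (phi b - phi a - phi' a (b - a)),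
    and the inequality between arithmetic and geometric means give, for every
    [lam > 0] ([norm_sub_le_bregman]),
      |b - a| <= lam (b + 2 a) / 3
                   + (phi b - phi a - phi' a (b - a)) / (2 lam).
    Take for a and b two consecutive values m_t and m_{t+1} of one coordinate
    of the martingale. The term phi' (m_t) (m_{t+1} - m_t) has zero mean,
    because phi' (m_t) depends on the past only ([ge0_integral_mul_comp]). So,
    with m_0 the constant a, summing over the [k] steps telescopes to
      sum_t E |m_{t+1} - m_t| <= lam k a + (E phi(m_k) - phi a) / (2 lam)
                              <= lam k a - phi a / (2 lam)
    ([sum_integral_abs_increments_le]). As ln is unbounded at 0, the
    argument is carried out for m_t + eps, and eps tends to 0 at the end.

    Summing over the coordinates bounds the variation by
    lam k + entropy p / (2 lam) ([l1_variation_le]), and the best [lam] gives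
    the square root ([le_sqrt_of_forall_le]). The second bound follows since
    the entropy on d points is at most ln d ([entropy_le_ln_card]). *)

(** * Pinsker's inequality for one coordinate *)

Section analysis.
Context {R : realType}.
Implicit Types a b x lam : R.

Lemma is_derive_ln_sub_rational x : 0 < x ->
  is_derive x 1 (fun y => ln y - (y - 1) * (5 * y + 1) / (2 * y * (y + 2)))
    ((x - 1) ^+ 3 / (x * (x + 2)) ^+ 2).
Proof.
move=> x0.
have d0 : 2 * x * (x + 2) != 0 by apply: lt0r_neq0; nra.
have Dln := is_derive1_ln x0.
have D1 : is_derive x 1 (fun y : R => 5 * y + 1) 5.
  by apply: is_derive_eq; rewrite /GRing.scale /=; ring.
have D2 : is_derive x 1 (fun y : R => (y - 1) * (5 * y + 1)) (10 * x - 4).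
  by apply: is_derive_eq; rewrite /GRing.scale /=; ring.
have D3 : is_derive x 1 (fun y : R => 2 * y * (y + 2)) (4 * x + 4).
  by apply: is_derive_eq; rewrite /GRing.scale /=; ring.
have D4 := @is_deriveV R (fun y => 2 * y * (y + 2)) x _ 1 d0 D3.
have D5 := is_deriveM D2 D4.
have D6 := is_deriveB Dln D5.
apply: (is_derive_eq D6).
rewrite /GRing.scale /=; field.
by apply/andP; split; apply: lt0r_neq0; lra.
Qed.

(** With x = b / a, this is [sqr_sub_le_bregman] solved for [ln x], which
    isolates the logarithm so that differentiating leaves a rational function.
    The derivative of the difference of the two sides has the sign of [x - 1]
    by [is_derive_ln_sub_rational], and the difference vanishes at [1]. *)
Lemma rational_le_ln x : 0 < x ->
  (x - 1) * (5 * x + 1) / (2 * x * (x + 2)) <= ln x.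
Proof.
move=> x0; rewrite -subr_ge0.
set f := fun y : R => ln y - (y - 1) * (5 * y + 1) / (2 * y * (y + 2)).
set df := fun y : R => (y - 1) ^+ 3 / (y * (y + 2)) ^+ 2.
have f1 : f 1 = 0 by rewrite /f ln1 subrr !mul0r subr0.
have Df (y : R) : 0 < y -> is_derive y 1 f (df y).
  exact: is_derive_ln_sub_rational.
have Cf a b : 0 < a -> {within `[a, b], continuous f}.
  move=> a0; apply: derivable_within_continuous => y.
  rewrite in_itv/= => /andP[ay _].
  by have [] := Df y (lt_le_trans a0 ay).
have Mf a b : 0 < a -> a <= b ->
    exists2 c, c \in `[a, b]%R & f b - f a = df c * (b - a).
  move=> a0 ab; apply: MVT_segment => // [y|]; last exact: Cf.
  by rewrite in_itv/= => /andP[ay _]; apply: Df; exact: lt_trans ay.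
change (0 <= f x); case: (leP 1 x) => [x1|/ltW x1].
- have [c] := Mf _ _ ltr01 x1; rewrite in_itv/= f1 subr0 => /andP[c1 _] ->.
  by rewrite mulr_ge0 ?subr_ge0// divr_ge0 ?sqr_ge0// exprn_ge0// subr_ge0.
- have [c] := Mf _ _ x0 x1; rewrite in_itv/= f1 sub0r => /andP[_ c1].
  move=> /eqP; rewrite eqr_oppLR => /eqP ->.
  have cube_le0 : (c - 1) ^+ 3 <= 0.
    by rewrite exprS mulr_le0_ge0 ?subr_le0 ?sqr_ge0.
  rewrite oppr_ge0 mulr_le0_ge0 ?subr_ge0// mulr_le0_ge0// invr_ge0.
  exact: sqr_ge0.
Qed.

(** This is [rational_le_ln] at [b / a], cleared of denominators; the last
    factor is the Bregman divergence of s ln s, that is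
    b ln (b / a) - b + a. *)
Lemma sqr_sub_le_bregman a b : 0 < a -> 0 < b ->
  3 * (b - a) ^+ 2 <=
    (2 * b + 4 * a) * (b * ln b - a * ln a - (ln a + 1) * (b - a)).
Proof.
move=> a0 b0.
have x0 : 0 < b / a by rewrite divr_gt0.
have := rational_le_ln x0.
rewrite ln_div// => h.
have {h}: b * ((b / a - 1) * (5 * (b / a) + 1) / (2 * (b / a) * (b / a + 2)))
    <= b * (ln b - ln a).
  by rewrite ler_pM2l.
have -> : b * ((b / a - 1) * (5 * (b / a) + 1) / (2 * (b / a) * (b / a + 2)))
    = (b - a) * (5 * b + a) / (2 * b + 4 * a).
  field; rewrite (lt0r_neq0 a0) (lt0r_neq0 b0) !andbT/=.
  by apply/andP; split; apply: lt0r_neq0; lra.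
rewrite ler_pdivrMr; last lra.
by move=> h; nra.
Qed.

(** With [u] and [v] the two terms on the right, [sqr_sub_le_bregman] says
    that the square of the left side is at most 4 u v, hence at most
    (u + v)^2. The bound is linear in expectations, unlike the square root
    of the divergence. *)
Lemma norm_sub_le_bregman lam a b : 0 < lam -> 0 < a -> 0 < b ->
  `|b - a| <= lam * (b + 2 * a) / 3
    + (2 * lam)^-1 * (b * ln b - a * ln a - (ln a + 1) * (b - a)).
Proof.
move=> l0 a0 b0; have := sqr_sub_le_bregman a0 b0.
set D := (b * ln b - _ - _) => h.
have D0 : 0 <= D.
  have s0 : 0 < 2 * b + 4 * a by lra.
  by rewrite -(pmulr_rge0 _ s0); apply: le_trans h; rewrite mulr_ge0// sqr_ge0.
set u := lam * (b + 2 * a) / 3; set v := (2 * lam)^-1 * D.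
have uv : `|b - a| ^+ 2 <= 4 * u * v.
  have -> : 4 * u * v = (2 * b + 4 * a) * D / 3.
    by rewrite /u /v; field; exact: lt0r_neq0.
  by rewrite real_normK ?num_real// ler_pdivlMr// mulrC.
have u0 : 0 <= u by rewrite /u divr_ge0// mulr_ge0; lra.
have v0 : 0 <= v by rewrite /v mulr_ge0// invr_ge0; lra.
rewrite -(@ler_pXn2r _ 2)// ?nnegrE ?addr_ge0//.
apply: le_trans uv _; rewrite -subr_ge0.
have -> : (u + v) ^+ 2 - 4 * u * v = (u - v) ^+ 2 by ring.
exact: sqr_ge0.
Qed.

(** Gibbs' inequality before summation: summed over two probability vectors
    [a] and [c], the difference [c - a] cancels. *)
Lemma mulr_ln_le_sub a c : 0 <= a -> 0 < c ->
  - (a * ln a) <= c - a + a * - ln c.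
Proof.
rewrite le_eqVlt => /predU1P[<-|a0] c0.
  by rewrite !mul0r oppr0 !addr0 ltW.
have h : -1 < c / a - 1 by rewrite ltrBrDr addNr divr_gt0.
have := le_ln1Dx h; rewrite addrC subrK ln_div// => {}h.
have : a * (ln c - ln a) <= a * (c / a - 1) by rewrite ler_pM2l.
have -> : a * (c / a - 1) = c - a by field; exact: lt0r_neq0.
lra.
Qed.

Lemma ler_of_forall_small (S X W : R) : 0 <= W ->
  (forall eps, 0 < eps -> eps <= 1 -> S <= X + W * eps) -> S <= X.
Proof.
move=> W0 h; rewrite leNgt; apply/negP => XS.
have d0 : 0 < S - X by rewrite subr_gt0.
have dW : 0 < S - X + W by rewrite ltr_wpDr.
have := h ((S - X) / (S - X + W)) (divr_gt0 d0 dW).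
rewrite ler_pdivrMr// mul1r lerDl => /(_ W0).
rewrite -lerBlDl mulrA ler_pdivlMr//; nra.
Qed.

(** The function s ln s is nonpositive on [0, 1]; this is what remains of that
    bound when a point of [0, 1] has been shifted by [e]. *)
Lemma mulr_ln_le (s e : R) : 0 < s -> 0 <= e -> s <= 1 + e ->
  s * ln s <= (1 + e) * e.
Proof.
move=> s0 e0 se.
have : ln s <= e.
  have h := @le_ln1Dx _ (s - 1).
  rewrite (_ : 1 + (s - 1) = s) in h; last by ring.
  by apply: (le_trans (h _)); lra.
have [l0 le|l0 _] := leP 0 (ln s); first by apply: ler_pM => //; exact: ltW.
rewrite (@le_trans _ _ 0)//; first by rewrite nmulr_lle0// ltW.
by rewrite mulr_ge0// addr_ge0.
Qed.

End analysis.

(** * Pulling out a factor known from the past *)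

Section pull.
Local Open Scope ereal_scope.
Context {R : realType} {d : measure_display} {T : measurableType d}
  {d' : measure_display} {U : measurableType d'}.
Import HBSimple HBNNSimple.

(** If [u] and [v] have the same conditional mean given [h], they have the
    same integral against any nonnegative function of [h]: for a simple
    function this is the hypothesis on its level sets, and monotone
    convergence along simple approximations of [g] does the rest. *)
Lemma ge0_integral_mul_comp (mu : {measure set T -> \bar R}) (u v : T -> R)
    (h : T -> U) (g : U -> R) :
  measurable_fun setT u -> measurable_fun setT v -> measurable_fun setT h ->
  measurable_fun setT g ->
  (forall w, 0 <= u w)%R -> (forall w, 0 <= v w)%R -> (forall y, 0 <= g y)%R ->
  (forall B : set U, measurable B ->
    \int[mu]_(w in h @^-1` B) (u w)%:E = \int[mu]_(w in h @^-1` B) (v w)%:E) ->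
  \int[mu]_w (u w * g (h w))%:E = \int[mu]_w (v w * g (h w))%:E.
Proof.
move=> mu_ mv mh mg u0 v0 g0 uv.
have mEg : @measurable_fun _ _ U (\bar R) setT (EFin \o g).
  exact/measurable_EFinP.
pose s n := nnsfun_approx measurableT mEg n.
have cvgs (f : T -> R) : measurable_fun setT f -> (forall w, 0 <= f w)%R ->
    \int[mu]_w (f w * s n (h w))%:E @[n --> \oo] -->
    \int[mu]_w (f w * g (h w))%:E.
  move=> mf f0.
  rewrite (_ : (\int[mu]_w (f w * g (h w))%:E) =
               \int[mu]_w (limn (fun n => (f w * s n (h w))%:E))); last first.
    apply: eq_integral => w _; apply/esym/cvg_lim => //.
    under eq_fun do rewrite EFinM; rewrite EFinM.
    apply: cvgeMl => //.
    apply: (@cvg_nnsfun_approx _ _ _ _ measurableT _ mEg) => // r _.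
    by rewrite lee_fin.
  apply: cvg_monotone_convergence => //.
  - move=> n; apply/measurable_EFinP; apply: measurable_funM => //.
    exact: measurableT_comp.
  - by move=> n w _; rewrite lee_fin mulr_ge0.
  - move=> w _ m n mn; rewrite lee_fin ler_wpM2l//.
    by have /lefP := nd_nnsfun_approx measurableT mEg mn; exact.
have sE (f : T -> R) n : measurable_fun setT f -> (forall w, 0 <= f w)%R ->
    \int[mu]_w (f w * s n (h w))%:E =
    \sum_(r \in range (s n))
      r%:E * \int[mu]_(w in h @^-1` (s n @^-1` [set r])) (f w)%:E.
  move=> mf f0.
  have mi r : measurable_fun setT (fun w => \1_(s n @^-1` [set r]) (h w) : R).
    by apply: measurableT_comp => //; exact: measurable_indic.
  transitivity (\int[mu]_w \sum_(r \in range (s n))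
      (r * (f w * \1_(s n @^-1` [set r]) (h w)))%:E).
    apply: eq_integral => w _.
    rewrite (fimfunE (s n) (h w)) fsumEFin// mulr_fsumr//.
    by congr EFin; apply: eq_fsbigr => r _; rewrite mulrCA.
  rewrite ge0_integral_fsum//.
  - apply: eq_fsbigr => r; rewrite inE => -[x _ <-].
    under eq_integral do rewrite EFinM.
    rewrite ge0_integralZl_EFin//.
    + congr (_ * _); rewrite [RHS]integral_mkcond.
      apply: eq_integral => w _; rewrite patchE indicE.
      have -> : (h w \in s n @^-1` [set s n x]) =
          (w \in h @^-1` (s n @^-1` [set s n x])).
        by apply/idP/idP; rewrite !inE.
      by case: ifP => _; rewrite ?mulr1 ?mulr0.
    + by move=> w _; rewrite lee_fin mulr_ge0.
    + by apply/measurable_EFinP; exact: measurable_funM.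
  - move=> r; apply/measurable_EFinP; apply: measurable_funM => //.
    exact: measurable_funM.
  - move=> r w _; rewrite lee_fin indicE.
    have [|_] := boolP (h w \in s n @^-1` [set r]); last by rewrite !mulr0.
    by rewrite inE/= => <-; rewrite !mulr_ge0.
have suv n : \int[mu]_w (u w * s n (h w))%:E = \int[mu]_w (v w * s n (h w))%:E.
  by rewrite !sE//; apply: eq_fsbigr => r _; rewrite uv.
apply: cvg_unique (cvgs _ mv v0) => //.
by rewrite -(funext suv); exact: cvgs.
Qed.
End pull.

(** * Martingales with values in [0, 1] *)

Section scalar.
Context {R : realType} {d : measure_display} {T : measurableType d}.
Variable P : probability T R.
Implicit Types (f g : T -> R) (eps lam : R).

Lemma bounded_integrable f (C : R) : measurable_fun setT f ->
  (forall w, `|f w| <= C) -> P.-integrable setT (EFin \o f).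
Proof.
move=> mf fC; apply: measurable_bounded_integrable => //.
  by rewrite (le_lt_trans (probability_le1 _ _)) ?ltry.
exists C; split; first exact: num_real.
by move=> M CM w _; exact: le_trans (fC w) (ltW CM).
Qed.

Lemma integrableDZ (a : R) f g : P.-integrable setT (EFin \o f) ->
  P.-integrable setT (EFin \o g) ->
  P.-integrable setT (EFin \o (fun w => a * f w + g w)).
Proof.
move=> fi gi.
have := integrableD measurableT (integrableZl measurableT a fi) gi.
by apply: eq_integrable.
Qed.

Lemma RintegralDZ (a : R) f g : P.-integrable setT (EFin \o f) ->
  P.-integrable setT (EFin \o g) ->
  (\int[P]_w (a * f w + g w) = a * \int[P]_w f w + \int[P]_w g w)%R.
Proof.
move=> fi gi; rewrite RintegralD//.
  by rewrite RintegralZl.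
have := integrableZl measurableT a fi.
by apply: eq_integrable.
Qed.

Lemma Rintegral_probability_cst (a : R) : (\int[P]_w a = a)%R.
Proof.
by rewrite Rintegral_cst// [X in fine X]probability_setT mulr1.
Qed.

Lemma ln_addr_bound eps (a : R) : 0 < eps -> 0 <= a <= 1 ->
  `|ln (a + eps)| <= `|ln eps| + `|ln (1 + eps)|.
Proof.
move=> e0 /andP[a0 a1].
have l1 : ln eps <= ln (a + eps) by rewrite ler_ln ?posrE ?lerDr ?ltr_wpDl.
have l2 : ln (a + eps) <= ln (1 + eps).
  by rewrite ler_ln ?posrE ?lerD2r ?ltr_wpDl.
rewrite ler_norml; apply/andP; split.
  apply: le_trans l1; rewrite lerNl (le_trans (ler_norm _))// normrN.
  by rewrite lerDl.
by rewrite (le_trans l2)// (le_trans (ler_norm _))// lerDr.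
Qed.

Section step.
Variables (eps lam : R) (m m' : T -> R).
Hypotheses (e0 : 0 < eps) (l0 : 0 < lam).
Hypotheses (mm : measurable_fun setT m) (mm' : measurable_fun setT m').
Hypotheses (m01 : forall w, 0 <= m w <= 1) (m'01 : forall w, 0 <= m' w <= 1).
Hypothesis mart : forall B : set R, measurable B ->
  (\int[P]_(w in m @^-1` B) (m' w)%:E = \int[P]_(w in m @^-1` B) (m w)%:E)%E.

(** [norm_sub_le_bregman] at [m w + eps] and [m' w + eps], integrated: the
    first two terms combine because [m] and [m'] have the same mean, and the
    derivative term drops out by [ge0_integral_mul_comp]. *)
Lemma Rintegral_abs_increment_le :
  (\int[P]_w `|m' w - m w| <= lam * ((\int[P]_w m w) + eps) + (2 * lam)^-1 *
     ((\int[P]_w ((m' w + eps) * ln (m' w + eps))) -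
      (\int[P]_w ((m w + eps) * ln (m w + eps)))))%R.
Proof.
(* The pulled-out factor has to be nonnegative on all of R, whereas only its
   values on [0, 1] matter; hence the shift by [c] and the absolute value. *)
pose c := ln (1 + eps).
pose g (a : R) := `|c - ln (a + eps)|.
have mln f : measurable_fun setT f ->
    measurable_fun setT (fun w => ln (f w + eps)).
  move=> mf; apply: (measurableT_comp (@measurable_ln R)).
  exact: measurable_funD.
have mg : measurable_fun [set: R] g.
  apply: measurableT_comp => //; apply: measurable_funB => //.
  apply: (measurableT_comp (@measurable_ln R)).
  exact: measurable_funD.
have nb f w : (forall w, 0 <= f w <= 1) -> `|f w| <= 1.
  by move=> /(_ w)/andP[f0 f1]; rewrite ger0_norm.
have gE w : g (m w) = c - ln (m w + eps).
  have /andP[m0 m1] := m01 w.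
  by rewrite /g ger0_norm// subr_ge0 ler_ln ?posrE ?lerD2r ?ltr_wpDl.
pose C := `|ln eps| + `|ln (1 + eps)|.
have gC w : `|g (m w)| <= C + C.
  rewrite gE; apply: (le_trans (ler_normB _ _)).
  apply: lerD; last exact: ln_addr_bound.
  by rewrite /C lerDr.
have im f : measurable_fun setT f -> (forall w, 0 <= f w <= 1) ->
    P.-integrable setT (EFin \o f).
  by move=> mf f01; apply: (@bounded_integrable _ 1) => // w; exact: nb.
have iphi f : measurable_fun setT f -> (forall w, 0 <= f w <= 1) ->
    P.-integrable setT (EFin \o (fun w => (f w + eps) * ln (f w + eps))).
  move=> mf f01; apply: (@bounded_integrable _ ((1 + eps) * C)).
    by apply: measurable_funM; [exact: measurable_funD|exact: mln].
  move=> w; rewrite normrM ler_pM//; last exact: ln_addr_bound.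
  by rewrite (le_trans (ler_normD _ _))// (ger0_norm (ltW e0)) lerD2r nb.
have ig f : measurable_fun setT f -> (forall w, 0 <= f w <= 1) ->
    P.-integrable setT (EFin \o (fun w => f w * g (m w))).
  move=> mf f01; apply: (@bounded_integrable _ (1 * (C + C))).
    by apply: measurable_funM => //; exact: measurableT_comp mm.
  by move=> w; rewrite normrM ler_pM// nb.
have Emm : (\int[P]_w m' w = \int[P]_w m w)%R.
  rewrite /Rintegral; congr fine.
  by have := mart measurableT; rewrite preimage_setT.
have Emg : (\int[P]_w (m' w * g (m w)) = \int[P]_w (m w * g (m w)))%R.
  rewrite /Rintegral; congr fine; apply: ge0_integral_mul_comp => //.
  - by move=> w; case/andP: (m'01 w).
  - by move=> w; case/andP: (m01 w).
  - by move=> a; rewrite /g.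
have icst : P.-integrable setT (EFin \o (fun w : T => lam * eps)).
  by apply: (@bounded_integrable _ `|lam * eps|).
(* The bound [F1] of the increment is a linear combination of [m'], [m],
   [phi m'], [phi m], [m' * g m], [m * g m] and a constant, nested so that
   its integral can be expanded one term at a time. *)
pose s := (2 * lam)^-1.
pose phi f w : R := (f w + eps) * ln (f w + eps).
pose F6 w := (- s) * (m w * g (m w)) + lam * eps.
pose F5 w := s * (m' w * g (m w)) + F6 w.
pose F4 w := (- s) * phi m w + F5 w.
pose F3 w := s * phi m' w + F4 w.
pose F2 w := (2 * lam / 3 + s * (c + 1)) * m w + F3 w.
pose F1 w := (lam / 3 - s * (c + 1)) * m' w + F2 w.
have i6 : P.-integrable setT (EFin \o F6).
  by apply: integrableDZ => //; exact: ig.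
have i5 : P.-integrable setT (EFin \o F5).
  by apply: integrableDZ => //; exact: ig.
have i4 : P.-integrable setT (EFin \o F4).
  by apply: integrableDZ => //; exact: iphi.
have i3 : P.-integrable setT (EFin \o F3).
  by apply: integrableDZ => //; exact: iphi.
have i2 : P.-integrable setT (EFin \o F2).
  by apply: integrableDZ => //; exact: im.
have i1 : P.-integrable setT (EFin \o F1).
  by apply: integrableDZ => //; exact: im.
have : (\int[P]_w `|m' w - m w| <= \int[P]_w F1 w)%R.
  apply: le_Rintegral => //.
    apply: (@bounded_integrable _ (1 + 1)).
      by apply: measurableT_comp => //; exact: measurable_funB.
    by move=> w; rewrite normr_id (le_trans (ler_normB _ _))// lerD// nb.
  move=> w _.
  have /andP[a0 _] := m01 w; have /andP[b0 _] := m'01 w.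
  have := @norm_sub_le_bregman R lam (m w + eps) (m' w + eps) l0.
  rewrite !ltr_wpDl// => /(_ isT isT).
  have -> : m' w + eps - (m w + eps) = m' w - m w by ring.
  move=> h; apply: (le_trans h); rewrite le_eqVlt; apply/orP; left; apply/eqP.
  by rewrite /F1 /F2 /F3 /F4 /F5 /F6 /phi gE -/s; field.
rewrite {1}/F1 (RintegralDZ _ (im _ mm' m'01) i2).
rewrite /F2 (RintegralDZ _ (im _ mm m01) i3).
rewrite /F3 (RintegralDZ _ (iphi _ mm' m'01) i4).
rewrite /F4 (RintegralDZ _ (iphi _ mm m01) i5).
rewrite /F5 (RintegralDZ _ (ig _ mm' m'01) i6).
rewrite /F6 (RintegralDZ _ (ig _ mm m01) icst).
rewrite Rintegral_probability_cst Emm Emg => h; apply: (le_trans h).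
rewrite le_eqVlt; apply/orP; left; apply/eqP.
by rewrite -/s /phi; field.
Qed.
End step.

(** The steps of [Rintegral_abs_increment_le] telescope; the last value of
    E phi is at most 0 up to an error of order [eps], and the first one is
    phi of the constant initial value. *)
Lemma sum_integral_abs_increments_le (k : nat) (m : nat -> T -> R) (a lam : R) :
  0 < lam -> (forall w, m 0 w = a) ->
  (forall t, (t <= k)%N -> measurable_fun setT (m t)) ->
  (forall t w, (t <= k)%N -> 0 <= m t w <= 1) ->
  (forall t, (t < k)%N -> forall B : set R, measurable B ->
    (\int[P]_(w in m t @^-1` B) (m t.+1 w)%:E =
     \int[P]_(w in m t @^-1` B) (m t w)%:E)%E) ->
  (\sum_(0 <= t < k) \int[P]_w `|m t.+1 w - m t w|%:E <=
    (lam * k%:R * a + (2 * lam)^-1 * - (a * ln a))%:E)%E.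
Proof.
move=> l0 m0 mm m01 mart.
have a01 : 0 <= a <= 1 by rewrite -(m0 (@point T)); exact: m01.
have mi t : (t <= k)%N -> P.-integrable setT (EFin \o m t).
  move=> tk; apply: (@bounded_integrable _ 1) => //; first exact: mm.
  by move=> w; have /andP[? ?] := m01 t w tk; rewrite ger0_norm.
have Di t : (t < k)%N ->
    P.-integrable setT (EFin \o (fun w => `|m t.+1 w - m t w|)).
  move=> tk; apply: (@bounded_integrable _ 1) => //.
    by apply: measurableT_comp => //; apply: measurable_funB;
      apply: mm => //; exact: ltnW.
  move=> w; have /andP[? ?] := m01 _ w tk; have /andP[? ?] := m01 _ w (ltnW tk).
  by rewrite normr_id ler_norml; apply/andP; split; lra.
have Em t : (t <= k)%N -> (\int[P]_w m t w = a)%R.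
  elim: t => [_|t IH tk].
    by under eq_Rintegral do rewrite m0; exact: Rintegral_probability_cst.
  rewrite -(IH (ltnW tk)) /Rintegral; congr fine.
  by have := mart _ tk _ measurableT; rewrite preimage_setT.
have -> : (\sum_(0 <= t < k) \int[P]_w `|m t.+1 w - m t w|%:E =
    (\sum_(0 <= t < k) (\int[P]_w `|m t.+1 w - m t w|)%R)%:E)%E.
  rewrite -sumEFin; apply: eq_big_nat => t tk.
  by rewrite /Rintegral fineK//; apply: integrable_fin_num => //; exact: Di.
rewrite lee_fin.
(* The comparison of [ln (a + eps)] with [ln a] used below needs [0 < a]; for
   [a = 0] all the [m t] have mean zero. *)
have [a0|a0] := eqVneq a 0.
  rewrite a0 mulr0 mul0r oppr0 mulr0 addr0.
  rewrite big_nat_cond sumr_le0// => t /andP[/andP[_ tk] _].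
  have := mi _ tk; have := mi _ (ltnW tk) => i0 i1.
  apply: (@le_trans _ _ (\int[P]_w (m t.+1 w + m t w))%R).
    apply: le_Rintegral => //; first exact: Di.
      have := integrableD measurableT i1 i0; exact: eq_integrable.
    move=> w _; have /andP[? ?] := m01 _ w tk.
    have /andP[? ?] := m01 _ w (ltnW tk).
    by rewrite ler_norml; apply/andP; split; lra.
  by rewrite RintegralD// !Em ?(ltnW tk)// a0 addr0.
have {a0} a0 : 0 < a by rewrite lt_neqAle eq_sym a0; case/andP: a01.
have a1 : a <= 1 by case/andP: a01.
have lna : ln a <= 0 by exact: ln_le0.
have s0 : 0 < (2 * lam)^-1 by rewrite invr_gt0; lra.
(* The constant [2 - ln a] adds the error (1 + eps) eps <= 2 eps of
   [mulr_ln_le] to that of replacing [ln (a + eps)] by [ln a]. *)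
apply: (@ler_of_forall_small _ _ _ (lam * k%:R + (2 * lam)^-1 * (2 - ln a))).
  by rewrite addr_ge0// mulr_ge0//; [exact: ltW|exact: ltW|lra].
move=> eps e0 e1.
pose phi t := (\int[P]_w ((m t w + eps) * ln (m t w + eps)))%R.
have step t : (t < k)%N -> (\int[P]_w `|m t.+1 w - m t w|)%R <=
    lam * (a + eps) + (2 * lam)^-1 * (phi t.+1 - phi t).
  move=> tk; rewrite -{1}(Em t (ltnW tk)).
  apply: Rintegral_abs_increment_le => //; try by [exact: mm|exact/mm/ltnW].
  - by move=> w; exact/m01/ltnW.
  - by move=> w; exact: m01.
  - by move=> B mB; exact: mart.
have phi0 : phi 0 = (a + eps) * ln (a + eps).
  rewrite /phi; under eq_Rintegral do rewrite m0.
  exact: Rintegral_probability_cst.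
have phik : phi k <= (1 + eps) * eps.
  rewrite -(Rintegral_probability_cst ((1 + eps) * eps)).
  apply: le_Rintegral => //.
  - apply: (@bounded_integrable _
      ((1 + eps) * (`|ln eps| + `|ln (1 + eps)|))).
      apply: measurable_funM; first by apply: measurable_funD => //; exact: mm.
      apply: (measurableT_comp (@measurable_ln R)).
      by apply: measurable_funD => //; exact: mm.
    move=> w; have mw := m01 k w (leqnn k); have /andP[? ?] := mw.
    rewrite normrM ler_pM//; last exact: ln_addr_bound.
    by rewrite ger0_norm; lra.
  - by apply: (@bounded_integrable _ `|(1 + eps) * eps|).
  - move=> w _; have /andP[? ?] := m01 k w (leqnn k).
    by apply: mulr_ln_le; lra.
apply: (@le_trans _ _ (\sum_(0 <= t < k)
    (lam * (a + eps) + (2 * lam)^-1 * (phi t.+1 - phi t)))).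
  by rewrite !big_mkord; apply: ler_sum => i _; exact: step.
rewrite big_split/= sumr_const_nat subn0 -mulr_sumr telescope_sumr// phi0.
have h1 : ln a <= ln (a + eps) by rewrite ler_ln ?posrE ?lerDl ?ltW// addr_gt0.
have h2 : phi k - (a + eps) * ln (a + eps) <= 2 * eps - (a + eps) * ln a.
  nra.
have h3 : (2 * lam)^-1 * (phi k - (a + eps) * ln (a + eps)) <=
    (2 * lam)^-1 * (2 * eps - (a + eps) * ln a) by rewrite ler_pM2l.
apply: (le_trans (lerD (lexx _) h3)).
by rewrite -mulr_natr le_eqVlt; apply/orP; left; apply/eqP; ring.
Qed.
End scalar.

(** * Sums over a countable set and the entropy *)

Section esum_count.
Local Open Scope ereal_scope.
Context {R : realType} {X : countType}.

Lemma esum_nneseries (a : X -> \bar R) : (forall x, 0 <= a x) ->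
  \esum_(x in [set: X]) a x = \sum_(n <oo) oapp a 0 (@pickle_inv X n).
Proof.
move=> a0.
have b0 n : 0 <= oapp a 0 (@pickle_inv X n) by case: (@pickle_inv X n) => /=.
rewrite nneseries_esumT//.
transitivity (\esum_(x in [set: X]) oapp a 0 (@pickle_inv X (pickle x))).
  by apply: eq_esum => x _; rewrite pickleK_inv.
rewrite -(@esum_image _ _ _ setT (@pickle X)
  (fun n => oapp a 0 (@pickle_inv X n))).
  rewrite esum_mkcond; apply: eq_esum => n _; case: ifPn => // /negP nn.
  case E : (@pickle_inv X n) => [x|//]; exfalso; apply: nn; rewrite inE.
  by exists x => //; have := @pickle_invK X n; rewrite E.
by move=> x y _ _; exact: (pcan_inj (@pickleK X)).
Qed.

(** Tonelli for an unordered sum: the index set is enumerated by [pickle]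
    so that the theorem on series over nat applies. *)
Lemma integral_esum {d : measure_display} {T : measurableType d}
    (mu : {measure set T -> \bar R}) (f : X -> T -> \bar R) :
  (forall x, measurable_fun setT (f x)) -> (forall x w, 0 <= f x w) ->
  \int[mu]_w (\esum_(x in [set: X]) f x w) =
  \esum_(x in [set: X]) \int[mu]_w f x w.
Proof.
move=> mf f0.
rewrite esum_nneseries; last by move=> x; exact: integral_ge0.
under eq_integral do rewrite esum_nneseries//.
rewrite integral_nneseries//.
- apply: eq_eseriesr => n _; case: (@pickle_inv X n) => [//|/=].
  by rewrite integral0.
- by move=> n; case: (@pickle_inv X n).
- by move=> n w _; case: (@pickle_inv X n) => /=.
Qed.

Lemma esumZ_le (c : R) (a : X -> \bar R) : (0 <= c)%R -> (forall x, 0 <= a x) ->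
  \esum_(x in [set: X]) (c%:E * a x) <= c%:E * \esum_(x in [set: X]) a x.
Proof.
move=> c0 a0; apply: ge_ereal_sup => _ [A fA <-].
rewrite -ge0_mule_fsumr//; apply: lee_wpmul2l; first by rewrite lee_fin.
by apply: ereal_sup_ubound; exists A.
Qed.

Lemma simplex_le1 (q : X -> R) x : simplex q -> (q x <= 1)%R.
Proof.
move=> [q0 q1]; rewrite -lee_fin -q1; apply: esum_ge.
by exists [set x]; [split|rewrite fsbig_set1].
Qed.

Lemma entropy_term_ge0 (q : X -> R) x : simplex q ->
  (0 <= - (q x * ln (q x)))%R.
Proof.
move=> sq; have [q0 _] := sq.
by rewrite oppr_ge0 mulr_ge0_le0// ln_le0// simplex_le1.
Qed.

Lemma entropy_ge0 (q : X -> R) : simplex q -> 0 <= entropy q.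
Proof.
by move=> sq; apply: esum_ge0 => x _; rewrite lee_fin entropy_term_ge0.
Qed.

End esum_count.

Section ent.
Local Open Scope ereal_scope.
Context {R : realType}.

(** Gibbs' inequality against the uniform vector. The mass of [p] is added to
    both sides, so that every summand stays nonnegative. *)
Lemma entropy_le_ln_card (X : finType) (p : X -> R) : simplex p ->
  entropy p <= (ln #|X|%:R)%:E.
Proof.
move=> sp; have [p0 p1] := sp.
have X0 : (0 < #|X|)%N.
  apply/card_gt0P; apply: contrapT => nX; move: p1.
  rewrite esum1; first by move=> /eqP; rewrite eq_sym onee_eq0.
  by move=> x; exfalso; apply: nX; exists x.
have XR : (0 < #|X|%:R :> R)%R by rewrite ltr0n.
have l0 : (0 <= ln #|X|%:R :> R)%R by rewrite ln_ge0// ler1n.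
have c0 : (0 < #|X|%:R^-1 :> R)%R by rewrite invr_gt0.
have cE : \esum_(x in [set: X]) (#|X|%:R^-1)%:E = 1 :> \bar R.
  rewrite esum_fset; [|exact: finite_finset|by move=> x _; rewrite lee_fin ltW].
  have <- : [set` enum X] = [set: X].
    by apply/seteqP; split => // x _; rewrite /= mem_enum.
  rewrite -fsbig_seq ?enum_uniq// big_enum sumEFin sumr_const.
  rewrite -(mulr_natr _^-1) mulVf//.
  exact: lt0r_neq0.
have : entropy p + 1 <= (ln #|X|%:R)%:E + 1.
  rewrite -{1}p1 -esumD; first last.
  - by move=> x _; rewrite lee_fin.
  - by move=> x _; rewrite lee_fin entropy_term_ge0.
  apply: (@le_trans _ _ (\esum_(x in [set: X])
      ((ln #|X|%:R)%:E * (p x)%:E + (#|X|%:R^-1)%:E))).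
    apply: le_esum => x _; rewrite -EFinM -!EFinD lee_fin.
    have := mulr_ln_le_sub (p0 x) c0; rewrite lnV ?posrE//; lra.
  rewrite esumD; first last.
  - by move=> x _; rewrite lee_fin ltW.
  - by move=> x _; rewrite mule_ge0// lee_fin.
  rewrite cE leeD2r// -[leRHS]mule1 -p1.
  by apply: esumZ_le => // x; rewrite lee_fin.
by rewrite leeD2rE.
Qed.

End ent.

(** * The bound on the variation *)

Section main.
Local Open Scope ereal_scope.
Context {R : realType}.

(** Each coordinate is a martingale in [0, 1], so this is the sum over the
    coordinates of [sum_integral_abs_increments_le]; the mass 1 of [p0] turns
    its first term into [lam * k]. *)
Lemma l1_variation_le (X : countType) {d : measure_display}
    {T : measurableType d} (P : probability T R) (k : nat) (p0 : X -> R) p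
    (lam : R) :
  simplex p0 -> simplex_martingale P k p0 p -> (0 < lam)%R ->
  l1_variation P k p <= (lam * k%:R)%:E + ((2 * lam)^-1)%:E * entropy p0.
Proof.
move=> sp0 [[pint pmart] psimp pstart] l0.
have mp t x : (t <= k)%N -> measurable_fun setT (fun w => p t w x).
  move=> tk _ B mB; rewrite setTI; have [_ + _] := pint t tk.
  by apply.
have mD t x : (t < k)%N ->
    measurable_fun setT (fun w => `|p t.+1 w x - p t w x|%:E).
  move=> tk; apply/measurable_EFinP; apply: measurableT_comp => //.
  by apply: measurable_funB; apply: mp => //; exact: ltnW.
have mDs x : measurable_fun setT
    (fun w => \sum_(0 <= t < k) `|p t.+1 w x - p t w x|%:E).
  under eq_fun do rewrite big_mkord.
  by apply: emeasurable_sum => t; exact: mD.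
have -> : l1_variation P k p =
    \esum_(x in [set: X]) \sum_(0 <= t < k)
      \int[P]_w `|p t.+1 w x - p t w x|%:E.
  rewrite /l1_variation.
  transitivity (\int[P]_w \esum_(x in [set: X])
      \sum_(0 <= t < k) `|p t.+1 w x - p t w x|%:E).
    apply: eq_integral => w _; rewrite big_add1/= /l1_norm esum_sum//.
  rewrite integral_esum//; last first.
    by move=> x w; apply: sume_ge0 => t _; rewrite lee_fin.
  apply: eq_esum => x _; under eq_integral do rewrite big_mkord.
  rewrite ge0_integral_sum//; last by move=> t; exact: mD.
  by rewrite big_mkord.
apply: (@le_trans _ _ (\esum_(x in [set: X]) ((lam * k%:R)%:E * (p0 x)%:E +
    ((2 * lam)^-1)%:E * (- (p0 x * ln (p0 x)))%:E))).
  apply: le_esum => x _.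
  apply: le_trans.
    apply: (@sum_integral_abs_increments_le _ _ _ P k
      (fun t w => p t w x) (p0 x) lam) => //.
    - by move=> w; rewrite pstart.
    - by move=> t tk; exact: mp.
    - move=> t w tk; have st := psimp t tk w.
      by rewrite simplex_le1// andbT; case: st.
    - move=> t tk B mB.
      have [|_ _ _] := pmart t.+1; first by rewrite ltnS leq0n.
      move=> /(_ (p t ^~ x @^-1` B)) -> //.
      by apply: sub_gen_smallest; exists t, x, B; split.
  by rewrite EFinD !EFinM.
have [p00 p01] := sp0.
have s0 : (0 <= (2 * lam)^-1)%R by rewrite invr_ge0; lra.
have lk : (0 <= lam * k%:R)%R by rewrite mulr_ge0// ltW.
rewrite esumD; first last.
- by move=> x _; rewrite mule_ge0// lee_fin// entropy_term_ge0.
- by move=> x _; rewrite mule_ge0// lee_fin.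
apply: leeD.
  by rewrite -[leRHS]mule1 -p01; apply: esumZ_le => // x; rewrite lee_fin.
by apply: esumZ_le => // x; rewrite lee_fin entropy_term_ge0.
Qed.

(** The right side is minimal at [lam] = sqrt (h / (2 k)), where its two
    terms are equal; for [h = 0] the infimum 0 is only approached, as [lam]
    tends to 0. *)
Lemma le_sqrt_of_forall_le (v : \bar R) (k : nat) (h : R) : (0 < k)%N ->
  (0 <= h)%R ->
  (forall lam, (0 < lam)%R -> v <= (lam * k%:R + (2 * lam)^-1 * h)%:E) ->
  v <= (Num.sqrt ((2 * k)%:R * h))%:E.
Proof.
move=> k0 + hv; have kR : (0 < k%:R :> R)%R by rewrite ltr0n.
rewrite le_eqVlt => /predU1P[h0|h0].
  apply/lee_addgt0Pr => e e0.
  apply: le_trans (hv (e / k%:R)%R (divr_gt0 e0 kR)) _.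
  by rewrite -h0 !mulr0 sqrtr0 add0r addr0 divfK// lt0r_neq0.
set s := Num.sqrt _.
have s2 : (s ^+ 2 = 2 * k%:R * h)%R.
  by rewrite sqr_sqrtr natrM// !mulr_ge0// ltW.
have s0 : (0 < s)%R by rewrite sqrtr_gt0 natrM !mulr_gt0.
have l0 : (0 < s / (2 * k%:R))%R by rewrite divr_gt0// mulr_gt0.
apply: (le_trans (hv _ l0)); rewrite lee_fin le_eqVlt; apply/orP; left.
have hE : h = (s ^+ 2 / (2 * k%:R))%R.
  by rewrite s2; field; exact: lt0r_neq0.
apply/eqP; rewrite hE; field.
by rewrite !lt0r_neq0.
Qed.

Lemma max_variation_le (X : countType) (k : nat) (p : X -> R) : (0 < k)%N ->
  simplex p -> max_variation k p <= sqrte ((2 * k)%:R%:E * entropy p).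
Proof.
move=> k0 sp; have k2 : (0 < (2 * k)%:R :> R)%R by rewrite ltr0n muln_gt0.
apply: ge_ereal_sup => _ [d [T [P [q [sq ->]]]]].
have := entropy_ge0 sp.
have := fun lam => @l1_variation_le X d T P k p q lam sp sq.
case: (entropy p) => [h| |//] hl h0; last by rewrite gt0_muley ?lte_fin//= leey.
by rewrite -EFinM/=; exact: le_sqrt_of_forall_le.
Qed.

End main.

Theorem theorem1 (R : realType) (k : nat) (k_gt0 : (0 < k)%N) :
  (forall (X : countType) (p : X -> R), simplex p ->
     (max_variation k p <= sqrte ((2 * k)%:R%:E * entropy p))%E) /\
  (forall d : nat, (0 < d)%N ->
     (max_variation_card R k d
        <= (Num.sqrt ((2 * k)%:R * ln (d%:R : R))%R)%:E)%E).
Proof.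
split=> [X p sp|d d0]; first exact: max_variation_le.
apply: ge_ereal_sup => _ [X [p [<- sp ->]]].
apply: le_trans (max_variation_le k_gt0 sp) _.
have X0 : (0 <= ln #|X|%:R :> R)%R.
  rewrite -lee_fin; apply: le_trans (entropy_le_ln_card sp).
  exact: entropy_ge0.
rewrite -[leRHS]/(sqrte ((2 * k)%:R * ln #|X|%:R)%:E) lee_sqrt; last first.
  by rewrite lee_fin mulr_ge0.
by rewrite EFinM lee_wpmul2l ?lee_fin// entropy_le_ln_card.
Qed.
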